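(* Let $G$ be a graph with $q$ edges and minimum degree $\delta$. If $q\le \delta^2+\delta-1$ (as an inequality between integers), then $G$ is hamiltonian.
   Context: All graphs are finite and undirected, without loops or multiple edges. The order $n$ of a graph $G$ is its number of vertices, the size $q$ is its number of edges, and $\delta$ is its minimum vertex degree. A cycle of length $t$ in $G$ is a sequence $v_1v_2\ldots v_tv_1$ of distinct vertices $v_1,\ldots,v_t$ with $v_iv_{i+1}\in E(G)$ for each $i\in\{1,\ldots,t\}$, where $v_{t+1}=v_1$. By convention, cycles of length 1 and 2 are allowed: a cycle of length $2$, $v_1v_2v_1$, is just an edge $v_1v_2$, and a cycle of length $1$ is just a single vertex (no edge is required). A graph $G$ of order $n$ is hamiltonian if it contains a Hamilton cycle, i.e. a cycle of length $n$. In particular, under this convention the complete graph $K_2$ (and the one-vertex graph $K_1$) counts as hamiltonian; for $n\ge 3$ this is the usual notion of hamiltonicity. *)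

(* Defs.v *)
From mathcomp Require Import all_boot all_order all_algebra.
Set Implicit Arguments.
Unset Strict Implicit.
Unset Printing Implicit Defensive.

(* A finite simple graph is a symmetric, irreflexive relation e on a finType;
   these two properties are hypotheses of the statements that use e. *)

Definition edge_set (T : finType) (e : rel T) : {set {set T}} :=
  [set [set p.1; p.2] | p : T * T & e p.1 p.2].

Definition degree (T : finType) (e : rel T) (x : T) : nat :=
  #|[set y | e x y]|.

(* Every degree is at most #|T|, so the default value #|T| of the iterated
   minimum only matters when T is empty (and the result is then 0). *)
Definition min_degree (T : finType) (e : rel T) : nat :=
  \big[minn/#|T|]_(x : T) degree e x.

(* [path.cycle e [:: x]] is e x x, which fails in a loopless graph: the cycles
   of length 1 have to be allowed separately. For a symmetric e,
   [path.cycle e [:: x; y]] is just e x y. *)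
Definition graph_cycle (T : finType) (e : rel T) (c : seq T) : bool :=
  [&& 0 < size c, uniq c & (size c == 1) || cycle e c].

Definition hamiltonian (T : finType) (e : rel T) : Prop :=
  exists2 c : seq T, graph_cycle e c & size c = #|T|.

(* Main.v *)
Require Import Defs.
From mathcomp Require Import all_boot all_order all_algebra.
From mathcomp Require Import zify.
Import Order.TTheory GRing.Theory Num.Theory.

Set Implicit Arguments.
Unset Strict Implicit.
Unset Printing Implicit Defensive.

(** Let d be the minimum degree, n the order and q the number of edges, and
    suppose that the graph is not hamiltonian. The hypothesis says that
    q < d (d + 1), that is, the degrees sum to less than 2 d (d + 1). As this
    sum is at least n d, n <= 2 d + 1 ([hamiltonian_sum_degree]).

    The first half is the classical argument of Dirac and Ore. On a path
    s_0 ... s_k whose ends u = s_0 and w = s_k have all their neighbours on the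
    path, an index i with u ~ s_(i+1) and w ~ s_i (a crossing) turns the path
    into a cycle through the same vertices. If no index is a crossing, then
    deg u + deg w <= k ([end_degrees]). So a non-spanning path always extends:
    its ends have a neighbour outside, or it closes to a cycle, which an edge
    leaves since n <= 2 d + 1 ([longer_path]). Hence there is a spanning path,
    and [end_degrees] applied to it forces n = 2 d + 1; moreover, it shows that
    for each i exactly one of u ~ s_(i+1) and w ~ s_i holds
    ([spanning_path_ends]).

    It remains to treat n = 2 d + 1, where the bound on q is sharp, by finding
    one of two dense configurations.

    If some cycle misses exactly one vertex x, then x together with the
    successors on the cycle of its neighbours is an independent set of at least
    d + 1 vertices, so q >= d (d + 1) ([almost_spanning_cycle]). Equality
    holds for K_(d,d+1), which is not hamiltonian.

    Otherwise, u ~ s_(j+2) never follows w ~ s_j, which would give a cycle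
    through all vertices except s_(j+1). By the dichotomy above, u ~ s_(i+1)
    then holds on an initial segment of indices i, so u is adjacent to
    s_1, ..., s_d ([head_neighbours]). Reversing an initial segment of the path
    gives other spanning paths to which this applies, and it follows that s_d
    is adjacent to all the other vertices ([middle_degree]). Then the degree sum
    is at least 2 d + 2 d d, again too much. Equality holds for two copies of
    K_(d+1) sharing a vertex, which is not hamiltonian. *)

Lemma hamiltonian_dec (T : finType) (e : rel T) :
  hamiltonian e \/ ~ hamiltonian e.
Proof.
case: (boolP [exists t : #|T|.-tuple T, graph_cycle e t]) => [/existsP[t ct]|].
  by left; exists t; rewrite ?size_tuple.
move=> /existsPn noc; right => -[c cc sz].
by have /negP := noc (tcast sz (in_tuple c)); rewrite val_tcast.
Qed.

(** * Degrees and edges *)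

Lemma min_degree_le (T : finType) (e : rel T) (x : T) :
  min_degree e <= degree e x.
Proof.
rewrite /min_degree; have := mem_index_enum x.
elim: (index_enum T) => [//|y r IHr]; rewrite inE big_cons geq_min.
by case/orP=> [/eqP-> | /IHr ->]; rewrite ?leqnn ?orbT.
Qed.

Section Graph.
Variables (T : finType) (e : rel T).
Hypotheses (e_sym : symmetric e) (e_irr : irreflexive e).

(** Each edge is the image of at most two ordered pairs of adjacent
    vertices. *)
Lemma sum_degree_le : \sum_x degree e x <= 2 * #|edge_set e|.
Proof.
pose A := [set p : T * T | e p.1 p.2].
have -> : \sum_x degree e x = \sum_(p in A) 1.
  under eq_bigr => x _ do rewrite /degree -sum1_card.
  by rewrite pair_big_dep; apply: eq_bigl => -[x y]; rewrite !inE.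
have -> : edge_set e = [set [set p.1; p.2] | p in A].
  by apply/setP => E; apply/imsetP/imsetP => -[p pA ->]; exists p; rewrite ?inE in pA *.
rewrite (partition_big_imset (fun p : T * T => [set p.1; p.2])) /=.
rewrite -sum1_card big_distrr /=; apply: leq_sum => E /imsetP[[a b] _ ->].
rewrite sum1_card (leq_trans (subset_leq_card _) (card_size [:: (a, b); (b, a)])) //.
apply/subsetP => -[x y]; rewrite !inE /= => /andP[exy /eqP /= eqE].
have xy : x != y by apply: contraTneq exy => ->; rewrite inE /= e_irr.
have: x \in [set a; b] by rewrite -eqE !inE eqxx.
have: y \in [set a; b] by rewrite -eqE !inE eqxx orbT.
rewrite !inE !xpair_eqE.
by do 2![case/orP=> /eqP ?]; subst; rewrite ?eqxx ?orbT ?andbT // in xy *.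
Qed.

(** All neighbours of I lie outside I, so the degree sum of I counts edges that
    the degree sum of the complement counts too. *)
Lemma independent_sum_degree_le (I : {set T}) :
    {in I &, forall x y, ~~ e x y} ->
  2 * \sum_(x in I) degree e x <= \sum_x degree e x.
Proof.
move=> indI; rewrite mul2n -addnn [leqRHS](bigID (mem I)) /= leq_add2l.
have degE x : degree e x = \sum_y e x y.
  rewrite /degree -sum1_card big_mkcond; apply: eq_bigr => y _.
  by rewrite inE; case: (e x y).
under eq_bigr => x _ do rewrite degE.
under [leqRHS]eq_bigr => x _ do rewrite degE.
rewrite exchange_big (bigID (mem I)) /= big1 => [|y Iy]; last first.
  by rewrite big1 // => x Ix; rewrite (negbTE (indI _ _ Ix Iy)).
apply: leq_sum => y _; rewrite [leqRHS](bigID (mem I)) /=.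
by under eq_bigr => x _ do rewrite e_sym; apply: leq_addr.
Qed.

(** * Rearranging paths and cycles *)

Lemma sorted_rev s : sorted e (rev s) = sorted e s.
Proof. by rewrite rev_sorted; apply: eq_sorted => x y; rewrite e_sym. Qed.

Lemma sorted_cat_edge x0 (a b : seq T) :
    sorted e a -> sorted e b -> e (last x0 a) (head x0 b) ->
  sorted e (a ++ b).
Proof.
case: a b => [|x a] [|y b] //= pa pb elast; first by rewrite cats0.
by rewrite cat_path pa /= elast.
Qed.

(** Two paths with adjacent first vertices and adjacent last vertices form a
    cycle, one of them being traversed backwards. All the cycles below that are
    not given by rotation or insertion are instances of this. *)
Lemma splice_cycle x0 (a b : seq T) :
    0 < size a -> 0 < size b -> sorted e a -> sorted e b ->
    e (head x0 a) (head x0 b) -> e (last x0 a) (last x0 b) ->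
  cycle e (a ++ rev b).
Proof.
case: a b => [//|x a] [//|y b] _ _ /= pa pb exy elast.
rewrite rcons_cat cat_path pa /=.
have := rev_path e x (rcons (y :: b) (last x a)).
rewrite last_rcons belast_rcons rev_cons => ->.
under eq_path => u v do rewrite e_sym.
by rewrite rcons_path /= exy pb e_sym.
Qed.

Lemma prev_head (c p : seq T) i a : uniq c -> rot i c = a :: p ->
  prev c a = last a p.
Proof.
move=> uc rotE; rewrite -(prev_rot i uc) rotE prev_nth mem_head.
have /andP[ap _] : uniq (a :: p) by rewrite -rotE rot_uniq.
by rewrite (memNindex ap) -[last a p]/(last a (a :: p)) -nth_last.
Qed.

(** * Crossings between the ends of a path *)

(** The neighbours of u are at positions i + 1, those of w at positions i, for
    i < k := size s - 1. Without a crossing the two sets of indices i are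
    disjoint in {0, ..., k - 1}, and if their sizes add up to k then they
    cover it. *)
Lemma end_degrees x0 (s : seq T) (u := head x0 s) (w := last x0 s) :
    (forall y, e u y -> y \in s) -> (forall y, e w y -> y \in s) ->
    (forall i, i.+1 < size s -> e u (nth x0 s i.+1) -> ~~ e w (nth x0 s i)) ->
  degree e u + degree e w <= (size s).-1 /\
  ((size s).-1 <= degree e u + degree e w ->
   forall i, i.+1 < size s -> ~~ e u (nth x0 s i.+1) -> e w (nth x0 s i)).
Proof.
move=> Nu Nw nocross; move defk: (size s).-1 => k.
pose A := [set i : 'I_k | e u (nth x0 s i.+1)].
pose B := [set i : 'I_k | e w (nth x0 s i)].
have leA : degree e u <= #|A|.
  apply: leq_trans (leq_imset_card (fun i : 'I_k => nth x0 s i.+1) A).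
  apply: subset_leq_card; apply/subsetP => y; rewrite inE => euy.
  have ys := Nu y euy; have ilt : index y s < size s by rewrite index_mem.
  have yE := nth_index x0 ys.
  case: (index y s) ilt yE => [|i] ilt yE.
    by move: euy; rewrite -yE nth0 e_irr.
  have ik : i < k by lia.
  by apply/imsetP; exists (Ordinal ik); rewrite ?inE /= yE.
have leB : degree e w <= #|B|.
  apply: leq_trans (leq_imset_card (fun i : 'I_k => nth x0 s i) B).
  apply: subset_leq_card; apply/subsetP => y; rewrite inE => ewy.
  have ys := Nw y ewy; have ilt : index y s < size s by rewrite index_mem.
  have yE := nth_index x0 ys.
  have ik : index y s < k.
    have : index y s != k.
      by apply: contraTneq ewy => ik; rewrite -yE ik -defk nth_last e_irr.
    by lia.
  by apply/imsetP; exists (Ordinal ik); rewrite ?inE /= yE.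
have cardAB : #|A :|: B| = #|A| + #|B|.
  rewrite cardsU (_ : A :&: B = set0) ?cards0 ?subn0 //.
  apply/setP => -[i ik]; rewrite !inE /=; apply/negbTE/andP => -[eA eB].
  by have /negP[] : ~~ e w (nth x0 s i) by apply: nocross => //; lia.
have leAB : #|A :|: B| <= k by rewrite -[leqRHS]card_ord max_card.
split=> [|lek i ilt nei]; first by rewrite cardAB in leAB; lia.
have ik : i < k by lia.
have /eqP/setP/(_ (Ordinal ik)) : A :|: B == setT.
  by rewrite eqEcard subsetT cardsT card_ord; lia.
by rewrite !inE /= (negbTE nei).
Qed.

Lemma head_take_drop (x0 : T) i (s : seq T) : i.+1 < size s ->
  [/\ head x0 (take i.+1 s) = head x0 s, last x0 (take i.+1 s) = nth x0 s i,
      head x0 (drop i.+1 s) = nth x0 s i.+1 & last x0 (drop i.+1 s) = last x0 s].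
Proof.
move=> ilt; rewrite -!nth_last -!nth0 !nth_drop !nth_take ?size_drop ?size_takel //; try lia.
rewrite addn0; split=> //; congr nth; lia.
Qed.

Lemma crossing_cycle x0 (s : seq T) i : sorted e s -> i.+1 < size s ->
    e (head x0 s) (nth x0 s i.+1) -> e (last x0 s) (nth x0 s i) ->
  cycle e (take i.+1 s ++ rev (drop i.+1 s)).
Proof.
move=> ps ilt euv ewv; have [h1 l1 h2 l2] := head_take_drop x0 ilt.
apply: (@splice_cycle x0); rewrite ?size_takel ?size_drop ?take_sorted ?drop_sorted //; try lia.
  by rewrite h1 h2.
by rewrite l1 l2 e_sym.
Qed.

Lemma crossing_perm i (s : seq T) : perm_eq (take i s ++ rev (drop i s)) s.
Proof. by rewrite -[s in perm_eq _ s](cat_take_drop i) perm_cat2l perm_rev. Qed.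

Lemma hamiltonian_cycle (c : seq T) :
  uniq c -> cycle e c -> 0 < size c -> size c = #|T| -> hamiltonian e.
Proof. by move=> uc ec c0 sc; exists c; rewrite // /graph_cycle c0 uc ec orbT. Qed.

(** * Existence of a spanning path *)

Section MinDegree.
Variable d : nat.
Hypothesis min_deg : forall x, d <= degree e x.

(** Otherwise a vertex of c would have its at least d neighbours in c, and a
    vertex outside c would have them outside c, so that n >= 2 (d + 1). *)
Lemma exit_edge (c : seq T) : #|T| <= d.*2.+1 -> uniq c -> 0 < size c < #|T| ->
  exists y z, [/\ y \in c, z \notin c & e z y].
Proof.
move=> leT uc /andP[c0 cT].
pose C := [set x in c].
have cardC : #|C| = size c by rewrite cardsE; apply/card_uniqP.
case: (boolP [exists y in C, exists z in ~: C, e z y]).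
  case/exists_inP=> y yC /exists_inP[z zC ezy]; exists y, z.
  by rewrite !inE in yC zC.
move=> /exists_inPn noexit.
have bound x (X : {set T}) : x \in X -> (forall y, e x y -> y \in X) -> d < #|X|.
  move=> xX NX; apply: leq_ltn_trans (min_deg x) _; rewrite /degree; apply: proper_card.
  apply/properP; split; first by apply/subsetP => y; rewrite inE => /NX.
  by exists x => //; rewrite inE e_irr.
have [x xC] : exists x, x \in C by apply/card_gt0P; rewrite cardC.
have [z zC] : exists z, z \in ~: C.
  by apply/card_gt0P; have := cardsC C; lia.
have dC : d < #|C|.
  apply: (bound x) => // y exy; have /exists_inPn noz := noexit x xC.
  by apply: contraTT (exy) => yC; rewrite e_sym; apply: noz; rewrite inE.
have dC' : d < #|~: C|.
  apply: (bound z) => // y ezy; rewrite inE; apply: contraTN (ezy) => yC.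
  by have /exists_inPn := noexit y yC; apply.
by have := cardsC C; lia.
Qed.

(** When no end of s has a neighbour outside s, the degrees of the ends sum to at
    least 2 d > size s - 1. This yields a crossing, hence a cycle on the
    vertices of s, and that cycle is cut open where an edge leaves it. *)
Lemma longer_path (s : seq T) : #|T| <= d.*2.+1 -> 0 < size s < #|T| ->
    uniq s -> sorted e s ->
  exists s' : seq T, [/\ size s' = (size s).+1, uniq s' & sorted e s'].
Proof.
move=> leT /andP[s0 sT] us ps.
have [x0 _] : exists x0 : T, true by case: s s0 {sT us ps} => // x0; exists x0.
case: (boolP [exists y, e (head x0 s) y && (y \notin s)]).
  case/existsP=> y /andP[eyx ys]; exists (y :: s).
  split; rewrite ?cons_uniq ?ys //.
  by case: s s0 ps eyx {sT us ys} => //= x p _ ->; rewrite e_sym => ->.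
move=> /existsPn exu.
case: (boolP [exists y, e (last x0 s) y && (y \notin s)]).
  case/existsP=> y /andP[eyx ys]; exists (rcons s y).
  split; rewrite ?size_rcons ?rcons_uniq ?ys //.
  by case: s s0 ps eyx {sT us ys exu} => //= x p _ ps eyx; rewrite rcons_path ps.
move=> /existsPn exw.
have Nu y : e (head x0 s) y -> y \in s.
  by move=> ey; have := exu y; rewrite ey negbK.
have Nw y : e (last x0 s) y -> y \in s.
  by move=> ey; have := exw y; rewrite ey negbK.
case: (boolP [exists i : 'I_(size s).-1,
    e (head x0 s) (nth x0 s i.+1) && e (last x0 s) (nth x0 s i)]); last first.
  move=> /existsPn noi.
  have [] := end_degrees Nu Nw.
    move=> i ilt eu; have ik : i < (size s).-1 by lia.
    by have := noi (Ordinal ik); rewrite /= eu.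
  have := min_deg (head x0 s); have := min_deg (last x0 s); lia.
case/existsP=> -[i ilt] /= /andP[eu ew].
have {}ilt : i.+1 < size s by lia.
have ec := crossing_cycle ps ilt eu ew.
have := crossing_perm i.+1 s; set c := _ ++ _ in ec * => pcs.
have uc : uniq c by rewrite (perm_uniq pcs).
have sc := perm_size pcs.
have [y [z [yc zc ezy]]] : exists y z, [/\ y \in c, z \notin c & e z y].
  by apply: exit_edge; rewrite ?sc ?s0.
have [j q rotE] := rot_to yc.
exists (z :: y :: q); split.
- by rewrite -rotE -sc /= size_rot.
- by rewrite -rotE /= rot_uniq mem_rot zc.
- by rewrite /= ezy; move: ec; rewrite -(rot_cycle j) rotE /= rcons_path => /andP[].
Qed.

Lemma spanning_path : 0 < #|T| <= d.*2.+1 ->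
  exists s : seq T, [/\ size s = #|T|, uniq s & sorted e s].
Proof.
case/andP=> T0 leT.
suff H k : k < #|T| -> exists s : seq T, [/\ size s = k.+1, uniq s & sorted e s].
  by have [|s [ss us ps]] := H #|T|.-1; [lia | exists s; rewrite ss prednK].
elim: k => [|k IHk] ltk.
  by have /card_gt0P[x _] := T0; exists [:: x].
have [|s [ss us ps]] := IHk; first by lia.
by rewrite -ss; apply: longer_path => //; rewrite ss.
Qed.

(** * Spanning paths of a non-hamiltonian graph *)

Section NonHamiltonian.
Hypothesis nonham : ~ hamiltonian e.

Lemma spanning_mem (s : seq T) : uniq s -> size s = #|T| -> forall x : T, x \in s.
Proof.
move=> us ss x; have /card_uniqP := us; rewrite ss => cs.
have /subset_cardP : #|s| = #|T| by [].
by move=> /(_ (subset_predT _)) ->.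
Qed.

(** A crossing would now close the path to a Hamilton cycle. For n <= 2 d + 1 the
    bound deg u + deg w <= n - 1 is attained, which makes the two sets of
    indices complementary. *)
Lemma spanning_path_ends x0 (s : seq T) (u := head x0 s) (w := last x0 s) :
    uniq s -> size s = #|T| -> sorted e s ->
  d.*2 < #|T| /\ (#|T| <= d.*2.+1 ->
   forall i, i.+1 < size s -> e w (nth x0 s i) = ~~ e u (nth x0 s i.+1)).
Proof.
move=> us ss ps; have ins := spanning_mem us ss.
have T0 : 0 < #|T| by apply/card_gt0P; exists x0.
have nocross i : i.+1 < size s -> e u (nth x0 s i.+1) -> ~~ e w (nth x0 s i).
  move=> ilt eu; apply/negP => ew; apply: nonham.
  have ec := crossing_cycle ps ilt eu ew; have pcs := crossing_perm i.+1 s.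
  apply: (hamiltonian_cycle _ ec); rewrite ?(perm_uniq pcs) ?(perm_size pcs) ?ss//.
have [|||ub cov] := @end_degrees x0 s => //.
have := min_deg (head x0 s); have := min_deg (last x0 s) => du dw.
split=> [|leT i ilt]; first by lia.
apply/idP/idP => [ew|]; first by apply: contraTN ew => /nocross->.
by apply: cov => //; lia.
Qed.

(** * A cycle missing exactly one vertex *)

(** The successors y+ on c of the neighbours y of the missing vertex x form,
    together with x, an independent set of size at least d + 1. If x ~ y+, then
    x can be inserted between y and y+. If y+ ~ z+, then the cycle
    x z ... y+ z+ ... y x, whose part from z to y+ runs backwards along c, is a
    Hamilton cycle. *)
Lemma almost_spanning_cycle (c : seq T) : uniq c -> cycle e c -> (size c).+1 = #|T| ->
  2 * (d.+1 * d) <= \sum_x degree e x.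
Proof.
move=> uc ec sc.
have [x xc] : exists x, x \notin c.
  have /card_uniqP cc := uc.
  have [x] : exists x, x \in [predC c].
    by apply/card_gt0P; rewrite -(ltn_add2l #|c|) cardC addn0 cc -sc.
  by exists x.
have Nc y : y \in c = (y != x).
  (* x :: c is duplicate-free of size n, hence exhausts the vertices. *)
  have uxc : uniq (x :: c) by rewrite /= xc.
  have := spanning_mem uxc sc y; rewrite inE.
  by case: eqP => [->|]; rewrite ?(negbTE xc).
pose S := [set next c y | y in [set y | e x y]].
have indS1 a : a \in S -> ~~ e x a.
  case/imsetP=> y; rewrite inE => exy ->; apply/negP => exa.
  have yc : y \in c by rewrite Nc; apply: contraTneq exy => ->; rewrite e_irr.
  have := yc; rewrite -mem_next => /rot_to[i p rotE].
  have lastE : last (next c y) p = y by rewrite -(prev_head uc rotE) prev_next.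
  apply: nonham; apply: (@hamiltonian_cycle (x :: rot i c)) => //=.
  - by rewrite mem_rot xc rot_uniq.
  - move: ec; rewrite -(rot_cycle i) rotE /= !rcons_path lastE exa (e_sym y x) exy.
    by case/andP=> ->.
  - by rewrite size_rot.
have indS2 : {in S &, forall a b, ~~ e a b}.
  move=> _ _ /imsetP[y Ny ->] /imsetP[z Nz ->]; rewrite !inE in Ny Nz.
  (* Read c from a on, as a :: p1 ++ b :: p2 with z the last vertex of a :: p1
     and y the last one of b :: p2. *)
  have [-> | yz] := eqVneq y z; first by rewrite e_irr.
  apply/negP => eab; set a := next c y in eab; set b := next c z in eab.
  have ab : a != b by rewrite (can_eq (prev_next uc)).
  have yc : y \in c by rewrite Nc; apply: contraTneq Ny => ->; rewrite e_irr.
  have zc : z \in c by rewrite Nc; apply: contraTneq Nz => ->; rewrite e_irr.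
  have /rot_to[i p rotE] : a \in c by rewrite mem_next.
  have bp : b \in p.
    have : b \in rot i c by rewrite mem_rot mem_next.
    by rewrite rotE inE eq_sym (negbTE ab).
  have lasty := prev_head uc rotE; rewrite prev_next // in lasty.
  case/splitPr: p / bp rotE lasty => p1 p2 rotE; rewrite last_cat /= => lasty.
  have lastz : z = last a p1.
    rewrite -[LHS](prev_next uc) -/b -(prev_rot i uc).
    have uci : uniq (rot i c) by rewrite rot_uniq.
    rewrite (@prev_head _ (p2 ++ a :: p1) (size (a :: p1)) _ uci) ?last_cat //.
    by rewrite rotE -cat_cons rot_size_cat.
  have pc : perm_eq ((a :: p1) ++ rev (b :: rcons p2 x)) (x :: c).
    apply: (@perm_trans _ ((a :: p1) ++ rcons (b :: p2) x)).
      by rewrite perm_cat2l perm_rev.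
    by rewrite -rcons_cat perm_rcons perm_cons cat_cons -rotE perm_rot.
  move: ec; rewrite -(rot_cycle i) rotE /= rcons_path cat_path /=.
  case/andP=> /and3P[pp1 _ pp2] _.
  apply: nonham; apply: (@hamiltonian_cycle ((a :: p1) ++ rev (b :: rcons p2 x))).
  - by rewrite (perm_uniq pc) /= xc.
  - apply: (@splice_cycle x) => //=; last by rewrite last_rcons -lastz e_sym.
    by rewrite rcons_path pp2 -lasty e_sym.
  - by [].
  - by rewrite (perm_size pc).
have ind : {in x |: S &, forall a b, ~~ e a b}.
  move=> a b /setU1P[->|aS] /setU1P[->|bS].
  - by rewrite e_irr.
  - exact: indS1.
  - by rewrite e_sym; apply: indS1.
  - exact: indS2.
apply: leq_trans (independent_sum_degree_le ind).
rewrite leq_mul2l /=; apply: (@leq_trans (#|x |: S| * d)); last first.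
  by rewrite -sum_nat_const; apply: leq_sum.
rewrite leq_mul2r cardsU1 card_imset; last by apply: can_inj (prev_next uc).
rewrite (_ : x \notin S) ?ltnS ?min_deg ?orbT //.
apply/imsetP => -[y]; rewrite inE => exy xE.
have : y \in c by rewrite Nc; apply: contraTneq exy => ->; rewrite e_irr.
by rewrite -mem_next -xE (negbTE xc).
Qed.

(** * The critical order *)

Section Tight.
Hypothesis cardT : #|T| = d.*2.+1.
Hypothesis d_gt0 : 0 < d.
Hypothesis few_edges : \sum_x degree e x < 2 * (d.+1 * d).

(** If the head is not adjacent to the vertex at position l + 1, it is not
    adjacent to the one at position l + 2 either: the last vertex would be
    adjacent to position l, and splicing would give a cycle that misses only
    position l + 1. So a gap at a position j + 1 <= d would leave the head with at
    most j < d neighbours. *)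
Lemma head_neighbours (x0 : T) (s : seq T) j :
    uniq s -> size s = #|T| -> sorted e s -> j < d ->
  e (head x0 s) (nth x0 s j.+1).
Proof.
move=> us ss ps jd; apply/idPn => nej.
have [_ alt] := spanning_path_ends x0 us ss ps.
have {}alt := alt (eq_leq cardT).
have nbr l : j <= l -> l.+1 < size s -> ~~ e (head x0 s) (nth x0 s l.+1).
  move=> /subnK <-; elim: (l - j) => [//|m IHm] ltm; rewrite addSn in ltm *.
  have ltm' : (m + j).+1 < size s by apply: ltnW.
  have em := IHm ltm'; apply/negP => eu.
  have ew : e (last x0 s) (nth x0 s (m + j)) by rewrite alt.
  have [h1 l1 _ _] := head_take_drop x0 ltm'.
  have [_ _ h2 l2] := head_take_drop x0 ltm.
  set a := take (m + j).+1 s in h1 l1; set b := drop (m + j).+2 s in h2 l2.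
  have sa : size a = (m + j).+1 by rewrite size_takel // ltnW.
  have sb : size b = size s - (m + j).+2 by rewrite size_drop.
  have sab : (size (a ++ rev b)).+1 = #|T| by rewrite size_cat size_rev sa sb; lia.
  have ec : cycle e (a ++ rev b).
    apply: (@splice_cycle x0); rewrite ?sa ?sb ?take_sorted ?drop_sorted //.
    - by lia.
    - by rewrite h1 h2.
    - by rewrite l1 l2 e_sym.
  have uc : uniq (a ++ rev b).
    have pab : perm_eq (a ++ rev b) (a ++ b) by rewrite perm_cat2l perm_rev.
    rewrite (perm_uniq pab); apply: subseq_uniq us.
    rewrite -[s in subseq _ s](cat_take_drop (m + j).+1) cat_subseq //.
    by rewrite /b -(add1n (m + j).+1) -drop_drop drop_subseq.
  by have := almost_spanning_cycle uc ec sab; rewrite leqNgt few_edges.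
suff : degree e (head x0 s) <= j by have := min_deg (head x0 s); lia.
pose f (i : 'I_j) := nth x0 s i.+1.
rewrite -[leqRHS]card_ord -cardsT; apply: leq_trans (leq_imset_card f setT).
rewrite /degree; apply: subset_leq_card; apply/subsetP => y; rewrite inE => euy.
have ys := spanning_mem us ss y; have yE := nth_index x0 ys.
have ilt : index y s < size s by rewrite index_mem.
case: (index y s) ilt yE => [|i] ilt yE; first by move: euy; rewrite -yE nth0 e_irr.
have ij : i < j.
  by rewrite ltnNge; apply/negP => ji; have := nbr i ji ilt; rewrite yE euy.
by apply/imsetP; exists (Ordinal ij); rewrite ?inE.
Qed.

(** The head of s is adjacent to position i + 1, so reversing the first i + 1
    vertices gives a spanning path that starts at position i of s and still has
    the same vertex at position d; [head_neighbours] applies to that path. *)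
Lemma middle_neighbours (x0 : T) (s : seq T) i :
    uniq s -> size s = #|T| -> sorted e s -> i < d ->
  e (nth x0 s i) (nth x0 s d).
Proof.
move=> us ss ps id.
have ilt : i.+1 < size s by rewrite ss cardT; lia.
have eu := head_neighbours x0 us ss ps id.
have [h1 l1 h2 _] := head_take_drop x0 ilt.
set a := take i.+1 s in h1 l1; set b := drop i.+1 s in h2.
have sa : size a = i.+1 by rewrite size_takel // ltnW.
have sE : a ++ b = s by rewrite cat_take_drop.
pose s' := rev a ++ b.
have ps's : perm_eq s' s by rewrite -[s in perm_eq _ s]sE perm_cat2r perm_rev.
have us' : uniq s' by rewrite (perm_uniq ps's).
have ss' : size s' = #|T| by rewrite (perm_size ps's).
have ra : last x0 (rev a) = head x0 s.
  by rewrite -h1; case: (a) sa => //= z a' _; rewrite rev_cons last_rcons.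
have ha : head x0 s' = nth x0 s i.
  by rewrite -l1 /s'; case/lastP: (a) sa => //= a' z _; rewrite rev_rcons last_rcons.
have so : sorted e s'.
  apply: (@sorted_cat_edge x0); rewrite ?sorted_rev ?take_sorted ?drop_sorted //.
  by rewrite ra h2.
have := head_neighbours x0 us' ss' so (ltac:(lia) : d.-1 < d).
rewrite ha prednK // /s' nth_cat size_rev sa ltnNge id /= nth_drop subnKC //.
Qed.

(** Position d is the middle of s, hence is fixed when s is reversed; the
    vertices after it are thus handled by [middle_neighbours] on the reversed
    path. *)
Lemma middle_degree (x0 : T) (s : seq T) :
    uniq s -> size s = #|T| -> sorted e s ->
  d.*2 <= degree e (nth x0 s d).
Proof.
move=> us ss ps; set m := nth x0 s d.
have -> : d.*2 = #|[set~ m]| by have := cardsC1 m; rewrite cardT => ->.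
rewrite /degree; apply: subset_leq_card; apply/subsetP => y; rewrite !inE => ym.
have ys := spanning_mem us ss y; rewrite -(nth_index x0 ys).
have ilt : index y s < size s by rewrite index_mem.
have ne : index y s != d by apply: contraNneq ym => yd; rewrite /m -yd nth_index.
have [id|] := ltnP (index y s) d; first by rewrite e_sym middle_neighbours.
rewrite leq_eqVlt eq_sym (negbTE ne) /= => di.
have ssd : size s = d.*2.+1 by rewrite ss.
have -> : m = nth x0 (rev s) d by rewrite nth_rev ssd /m; [congr nth|]; lia.
have -> : nth x0 s (index y s) = nth x0 (rev s) (size s - (index y s).+1).
  by rewrite nth_rev; [congr nth|]; lia.
by rewrite e_sym middle_neighbours ?rev_uniq ?size_rev ?sorted_rev //; lia.
Qed.

End Tight.
End NonHamiltonian.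

(** * Conclusion *)

Lemma hamiltonian_sum_degree :
  0 < #|T| -> 0 < d -> \sum_x degree e x < 2 * (d.+1 * d) -> hamiltonian e.
Proof.
move=> T0 d0 few; have [//|nonham] := hamiltonian_dec e; exfalso.
have leT : #|T| <= d.*2.+1.
  have : #|T| * d <= \sum_x degree e x.
    by rewrite -sum_nat_const; apply: leq_sum.
  by nia.
have [|s [ss us ps]] := spanning_path; first by rewrite T0.
have /card_gt0P[x0 _] := T0.
have [ltT _] := spanning_path_ends nonham x0 us ss ps.
have cardT : #|T| = d.*2.+1 by apply/eqP; rewrite eqn_leq leT.
have degm := middle_degree nonham cardT d0 few x0 us ss ps.
set m := nth x0 s d in degm.
(* The middle vertex has 2 d neighbours, each other vertex at least d. *)
have : d.*2 + d.*2 * d <= \sum_x degree e x.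
  rewrite (bigD1 m) //= leq_add // -[X in X * d]/(d.*2.+1.-1) -cardT -(cardC1 m).
  by rewrite -sum_nat_const; apply: leq_sum.
by move: few; nia.
Qed.

End MinDegree.
End Graph.

Theorem theorem1 (T : finType) (e : rel T)
  (e_sym : symmetric e) (e_irr : irreflexive e)
  (size_le : (#|edge_set e|%:Z <=
                (min_degree e)%:Z ^+ 2 + (min_degree e)%:Z - 1)%R) :
  hamiltonian e.
Proof.
have {}size_le : #|edge_set e| < (min_degree e).+1 * min_degree e.
  by move: size_le; rewrite expr2; nia.
have d0 : 0 < min_degree e by case: (min_degree e) size_le => //; rewrite muln0.
apply: (@hamiltonian_sum_degree T e e_sym e_irr (min_degree e)) => //.
- by move=> x; apply: min_degree_le.
- rewrite lt0n; apply: contraTneq d0 => T0.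
  by rewrite /min_degree big_pred0 ?T0 // => x; have := card0_eq T0 x.
- by apply: leq_ltn_trans (sum_degree_le e_irr) _; rewrite ltn_mul2l.
Qed.
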